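(* $\mathbf{FrmBisim}^{\mathrm{op}} \simeq \mathbf{CABAOBisim}$, via the functor sending a bisimulation $Q$ to $\mathrm{Low}(Q^{\dagger})$, where $Q^\dagger$ is the converse relation.
   Context: A Kripke frame $(X,R)$ is a set with a relation $R \subseteq X\times X$. For $Q \subseteq X \times Y$, $\mathrm{Low}(Q) \subseteq \mathcal{P}(X)\times\mathcal{P}(Y)$ is defined by $S \mathrel{\mathrm{Low}(Q)} T$ iff $\forall s\in S.\ \exists t \in T.\ s \mathrel{Q} t$. $Q$ between frames $(X,R),(Y,S)$ is a simulation if $x \mathrel{Q} y$, $x \mathrel{R} x'$ imply some $y'$ with $y \mathrel{S} y'$, $x' \mathrel{Q} y'$; a cosimulation if its converse $Q^\dagger$ is a simulation; a bisimulation if both. $\mathbf{FrmBisim}$: Kripke frames and bisimulations; taking converses gives $\mathbf{FrmBisim}^{\mathrm{op}} \cong \mathbf{FrmBisim}$. A CABA is a complete atomic Boolean algebra. A relation $Q \subseteq \mathcal{B}\times\mathcal{B}'$ between CABAs is directionally atomic if it is a bimodule ($p'\sqsubseteq p \mathrel{Q} q \sqsubseteq q' \Rightarrow p' \mathrel{Q} q'$), left-disjunctive ($a_i \mathrel{Q} b$ for all $i$ implies $\bigsqcup_i a_i \mathrel{Q} b$), and atomic-founded (for an atom $a$, $a \mathrel{Q} b$ implies $a \mathrel{Q} b'$ for some atom $b' \sqsubseteq b$). A CABAO is a CABA with a meet-preserving $\Box$; $\Diamond^{-}$ denotes its left adjoint ($\Diamond^{-} x \sqsubseteq y$ iff $x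 \sqsubseteq \Box y$); for a frame, $\Box_R(A)=\{w \mid \forall v.\ w\mathrel{R} v \Rightarrow v\in A\}$, $\Diamond^{-}_R(A) = \{w \mid \exists v\in A.\ v \mathrel{R} w\}$. $Q$ between CABAOs is simulatory if directionally atomic and $A \mathrel{Q} \Box B$ implies $\Diamond^{-} A \mathrel{Q} B$. The variant $Q^{\circ}$ of $Q$ is: $b' \mathrel{Q^{\circ}} b$ iff for every atom $a' \sqsubseteq b'$ there is an atom $a \sqsubseteq b$ with $a \mathrel{Q} a'$. $Q$ is cosimulatory if directionally atomic and $B \mathrel{Q^{\circ}} \Box_{\mathcal{B}} A$ implies $\Diamond^{-}_{\mathcal{B}'} B \mathrel{Q^{\circ}} A$; bisimulatory if both. $\mathbf{CABAOBisim}$: CABAOs and bisimulatory relations, identity $\sqsubseteq$. *)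

(* Defs.v *)
From mathcomp Require Import all_boot all_order.
From mathcomp Require Import boolp classical_sets.

Set Implicit Arguments.
Unset Strict Implicit.
Unset Printing Implicit Defensive.

Import Order.Theory.

Local Open Scope classical_set_scope.
Local Open Scope order_scope.

(* [comp f g] is written in diagrammatic order: first [f], then [g]. *)
Record category := Category {
  ob :> Type;
  hom : ob -> ob -> Type;
  idm : forall x, hom x x;
  comp : forall x y z, hom x y -> hom y z -> hom x z;
  comp_idl : forall x y (f : hom x y), comp (idm x) f = f;
  comp_idr : forall x y (f : hom x y), comp f (idm y) = f;
  comp_assoc : forall w x y z (f : hom w x) (g : hom x y) (h : hom y z),
    comp f (comp g h) = comp (comp f g) h }.

Arguments hom {c} x y.
Arguments idm {c} x.
Arguments comp {c x y z} f g.

Definition op_category (C : category) : category :=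
  @Category C (fun x y => @hom C y x) (@idm C) (fun x y z f g => comp g f)
    (fun x y f => comp_idr f) (fun x y f => comp_idl f)
    (fun w x y z f g h => esym (comp_assoc h g f)).

Record functor (C D : category) := Functor {
  fob :> C -> D;
  fmap : forall x y, hom x y -> hom (fob x) (fob y);
  fmap_id : forall x, fmap (idm x) = idm (fob x);
  fmap_comp : forall x y z (f : hom x y) (g : hom y z),
    fmap (comp f g) = comp (fmap f) (fmap g) }.

Arguments fmap {C D} F {x y} f : rename.

Definition id_functor (C : category) : functor C C :=
  @Functor C C id (fun x y f => f) (fun=> erefl) (fun _ _ _ _ _ => erefl).

Section FunctorComposition.
Variables (C D E : category) (F : functor C D) (G : functor D E).

Lemma comp_functor_id x : fmap G (fmap F (idm x)) = idm (G (F x)).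
Proof. by rewrite !fmap_id. Qed.

Lemma comp_functor_comp x y z (f : hom x y) (g : hom y z) :
  fmap G (fmap F (comp f g)) = comp (fmap G (fmap F f)) (fmap G (fmap F g)).
Proof. by rewrite !fmap_comp. Qed.

Definition comp_functor : functor C E :=
  @Functor C E (fun x => G (F x)) (fun x y f => fmap G (fmap F f))
    comp_functor_id comp_functor_comp.
End FunctorComposition.

Definition is_iso (C : category) (x y : C) (f : hom x y) : Prop :=
  exists g : hom y x, comp f g = idm x /\ comp g f = idm y.

Definition naturally_isomorphic (C D : category) (F G : functor C D) : Prop :=
  exists eta : forall x, hom (F x) (G x),
    (forall x y (f : hom x y),
       comp (fmap F f) (eta y) = comp (eta x) (fmap G f)) /\
    (forall x, is_iso (eta x)).

Definition is_equivalence (C D : category) (F : functor C D) : Prop :=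
  exists G : functor D C,
    naturally_isomorphic (comp_functor F G) (id_functor C) /\
    naturally_isomorphic (comp_functor G F) (id_functor D).

Definition converse (X Y : Type) (Q : X -> Y -> Prop) : Y -> X -> Prop :=
  fun y x => Q x y.

Definition rel_comp (X Y Z : Type) (Q : X -> Y -> Prop) (S : Y -> Z -> Prop) :
  X -> Z -> Prop := fun x z => exists2 y, Q x y & S y z.

Definition Low (X Y : Type) (Q : X -> Y -> Prop) : set X -> set Y -> Prop :=
  fun S T => forall s, S s -> exists2 t, T t & Q s t.

Record frame := Frame { world :> Type; acc : world -> world -> Prop }.

Arguments acc {X} w v : rename.

Definition simulation (X Y : frame) (Q : X -> Y -> Prop) : Prop :=
  forall x y x', Q x y -> acc x x' -> exists2 y', acc y y' & Q x' y'.

Definition cosimulation (X Y : frame) (Q : X -> Y -> Prop) : Prop :=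
  simulation (converse Q).

Definition bisimulation (X Y : frame) (Q : X -> Y -> Prop) : Prop :=
  simulation Q /\ cosimulation Q.

Record bisim (X Y : frame) := Bisim {
  bisim_rel :> X -> Y -> Prop;
  bisimP : bisimulation bisim_rel }.

Lemma bisim_eq (X Y : frame) (Q S : bisim X Y) :
  (forall x y, Q x y <-> S x y) -> Q = S.
Proof.
case: Q S => [Q HQ] [S HS] /= QS; have {}QS : Q = S by apply/predeq2P.
by subst S; rewrite (Prop_irrelevance HQ HS).
Qed.

Lemma simulation_id (X : frame) : simulation (@eq X).
Proof. by move=> x _ x' <- xx'; exists x'. Qed.

Lemma bisimulation_id (X : frame) : bisimulation (@eq X).
Proof.
split; first exact: simulation_id.
by move=> x _ x' -> xx'; exists x'.
Qed.

Lemma simulation_comp (X Y Z : frame) (Q : X -> Y -> Prop) (S : Y -> Z -> Prop) :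
  simulation Q -> simulation S -> simulation (rel_comp Q S).
Proof.
move=> sQ sS x z x' [y Qxy Syz] /(sQ _ _ _ Qxy)[y' yy' Qx'y'].
by have [z' zz' Sy'z'] := sS _ _ _ Syz yy'; exists z' => //; exists y'.
Qed.

Lemma bisimulation_comp (X Y Z : frame)
    (Q : X -> Y -> Prop) (S : Y -> Z -> Prop) :
  bisimulation Q -> bisimulation S -> bisimulation (rel_comp Q S).
Proof.
move=> [sQ cQ] [sS cS]; split; first exact: simulation_comp.
move=> z x z' [y Qxy Syz] /(cS _ _ _ Syz)[y' yy' Sy'z'].
by have [x' xx' Qx'y'] := cQ _ _ _ Qxy yy'; exists x' => //; exists y'.
Qed.

Definition bisim_id (X : frame) : bisim X X := Bisim (@bisimulation_id X).

Definition bisim_comp (X Y Z : frame) (Q : bisim X Y) (S : bisim Y Z) :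
  bisim X Z := Bisim (bisimulation_comp (bisimP Q) (bisimP S)).

Lemma bisim_idl (X Y : frame) (Q : bisim X Y) : bisim_comp (bisim_id X) Q = Q.
Proof. by apply: bisim_eq => x y; split=> [[_ <-]|] //; exists x. Qed.

Lemma bisim_idr (X Y : frame) (Q : bisim X Y) : bisim_comp Q (bisim_id Y) = Q.
Proof. by apply: bisim_eq => x y; split=> [[z + <-]|] //; exists y. Qed.

Lemma bisim_assoc (W X Y Z : frame)
    (Q : bisim W X) (S : bisim X Y) (T : bisim Y Z) :
  bisim_comp Q (bisim_comp S T) = bisim_comp (bisim_comp Q S) T.
Proof.
apply: bisim_eq => w z; split.
  by move=> [x Qwx [y Sxy Tyz]]; exists y => //; exists x.
by move=> [y [x Qwx Sxy] Tyz]; exists x => //; exists y.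
Qed.

Definition FrmBisim : category :=
  @Category frame bisim bisim_id bisim_comp bisim_idl bisim_idr bisim_assoc.

Definition atom (d : Order.disp_t) (B : ctbDistrLatticeType d) (a : B) : Prop :=
  a <> \bot /\ forall b, b <= a -> b = \bot \/ b = a.

(* The display is a phantom argument of the order structures of the library
   and carries no content. *)
Record caba := Caba {
  caba_disp : Order.disp_t;
  caba_sort :> ctbDistrLatticeType caba_disp;
  caba_complete : forall A : set caba_sort,
    supremums A !=set0 /\ infimums A !=set0;
  caba_atomic : forall b : caba_sort,
    b <> \bot -> exists2 a, atom a & a <= b }.

(* The library's [supremum] and [infimum] return their first argument on the
   empty set. *)
Definition bigjoin (B : caba) (A : set B) : B := supremum \bot A.
Definition bigmeet (B : caba) (A : set B) : B := infimum \top A.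

Section CabaTheory.
Variable B : caba.
Implicit Types (A : set B) (a b : B).

Lemma le_bigjoin A a : A a -> a <= bigjoin A.
Proof.
move=> Aa; rewrite /bigjoin /supremum; case: ifPn => [/eqP A0|_].
  by rewrite A0 in Aa.
have /(xgetPex \bot) [] := (caba_complete A).1.
by move=> ub _; exact: ub.
Qed.

Lemma bigjoin_le A b : (forall a, A a -> a <= b) -> bigjoin A <= b.
Proof.
move=> Ab; rewrite /bigjoin /supremum; case: ifPn => [_|_]; first exact: le0x.
have /(xgetPex \bot) [] := (caba_complete A).1.
by move=> _; apply.
Qed.

Lemma bigmeet_le A a : A a -> bigmeet A <= a.
Proof.
move=> Aa; rewrite /bigmeet /infimum; case: ifPn => [/eqP A0|_].
  by rewrite A0 in Aa.
have /(xgetPex \top) [] := (caba_complete A).2.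
by move=> lb _; exact: lb.
Qed.

Lemma le_bigmeet A b : (forall a, A a -> b <= a) -> b <= bigmeet A.
Proof.
move=> Ab; rewrite /bigmeet /infimum; case: ifPn => [_|_]; first exact: lex1.
have /(xgetPex \top) [] := (caba_complete A).2.
by move=> _; apply.
Qed.

Lemma atom_le_eq a b : atom a -> atom b -> a <= b -> a = b.
Proof. by move=> [a0 _] [_ hb] /hb []. Qed.

Lemma le_atoms b c :
  (forall a, atom a -> a <= b -> a <= c) -> b <= c.
Proof.
move=> bc; have [|/eqP] := eqVneq (b `&` ~` c) \bot.
  by move=> /eqP; rewrite -diffE diff_eq0.
move=> /(@caba_atomic B)[a ata]; rewrite lexI => /andP[ab aNc].
have ac := bc _ ata ab; case: (ata) => + _; case.
by apply/eqP; rewrite -lex0 -(meetxC c) lexI ac.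
Qed.

Lemma atom_le_bigjoin A a :
  (forall x, A x -> atom x) -> atom a -> a <= bigjoin A -> A a.
Proof.
move=> atA ata aA; apply: contrapT => nAa.
have : bigjoin A <= ~` a.
  apply: bigjoin_le => x Ax; rewrite -Order.CTBDistrLatticeTheory.disj_leC.
  have [//|xa] := eqVneq (x `&` a) \bot.
  have [_ hx] := atA _ Ax; case: (hx (x `&` a)); first exact: leIl.
    by move/eqP; rewrite (negPf xa).
  move=> /esym xE; have xlea : x <= a by rewrite xE leIr.
  by case: nAa; rewrite -(atom_le_eq (atA _ Ax) ata xlea).
move=> /(le_trans aA) aNa; case: ata => + _; case.
by apply/eqP; rewrite -lex0 -(meetxC a) lexI lexx.
Qed.

End CabaTheory.

Section DirectionallyAtomic.
Variables (B B' : caba) (Q : B -> B' -> Prop).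

Definition bimodule : Prop :=
  forall p p' q q', p' <= p -> Q p q -> q <= q' -> Q p' q'.

Definition left_disjunctive : Prop :=
  forall (A : set B) b, (forall a, A a -> Q a b) -> Q (bigjoin A) b.

Definition atomic_founded : Prop :=
  forall a b, atom a -> Q a b -> exists b', [/\ atom b', b' <= b & Q a b'].

Definition directionally_atomic : Prop :=
  [/\ bimodule, left_disjunctive & atomic_founded].

Definition variant : B' -> B -> Prop :=
  fun b' b => forall a', atom a' -> a' <= b' ->
    exists a, [/\ atom a, a <= b & Q a a'].

End DirectionallyAtomic.

Record cabao := Cabao {
  cabao_caba :> caba;
  box : cabao_caba -> cabao_caba;
  box_meet : forall A : set cabao_caba,
    box (bigmeet A) = bigmeet [set box a | a in A] }.

Arguments box {B} x : rename.

(* The left adjoint of [box]; see [diamP]. *)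
Definition diam (B : cabao) (x : B) : B := bigmeet [set y | x <= box y].

Section CabaoTheory.
Variable B : cabao.
Implicit Types x y : B.

Lemma box_mono x y : x <= y -> box x <= box y.
Proof.
move=> xy; have <- : bigmeet [set x; y] = x.
  apply: le_anti; rewrite bigmeet_le /=; last by left.
  by apply: le_bigmeet => _ [] ->.
by rewrite box_meet bigmeet_le //; exists y => //; right.
Qed.

Lemma le_box_diam x : x <= box (diam x).
Proof. by rewrite /diam box_meet; apply: le_bigmeet => _ [y xy <-]. Qed.

Lemma diamP x y : (diam x <= y) = (x <= box y).
Proof.
apply/idP/idP => [/box_mono|xy]; last exact: bigmeet_le.
exact/le_trans/le_box_diam.
Qed.

End CabaoTheory.

Section Bisimulatory.
Variables (B B' : cabao) (Q : B -> B' -> Prop).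

Definition simulatory : Prop :=
  directionally_atomic Q /\
  forall (a : B) (b : B'), Q a (box b) -> Q (diam a) b.

Definition cosimulatory : Prop :=
  directionally_atomic Q /\
  forall (b : B') (a : B), variant Q b (box a) -> variant Q (diam b) a.

Definition bisimulatory : Prop := simulatory /\ cosimulatory.

End Bisimulatory.

Record bisimul (B B' : cabao) := Bisimul {
  bisimul_rel :> B -> B' -> Prop;
  bisimulP : bisimulatory bisimul_rel }.

Lemma bisimul_eq (B B' : cabao) (Q S : bisimul B B') :
  (forall x y, Q x y <-> S x y) -> Q = S.
Proof.
case: Q S => [Q HQ] [S HS] /= QS; have {}QS : Q = S by apply/predeq2P.
by subst S; rewrite (Prop_irrelevance HQ HS).
Qed.

Lemma variant_bimodule (B B' : caba) (Q : B -> B' -> Prop) :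
  bimodule (variant Q).
Proof.
move=> p p' q q' p'p Qpq qq' a ata ap'.
have [b [atb bq Qba]] := Qpq a ata (le_trans ap' p'p).
by exists b; split=> //; exact: le_trans qq'.
Qed.

Lemma variant_comp (B B' B'' : caba) (Q : B -> B' -> Prop) (S : B' -> B'' -> Prop) :
  directionally_atomic Q -> directionally_atomic S ->
  forall c a, variant (rel_comp Q S) c a <-> rel_comp (variant S) (variant Q) c a.
Proof.
move=> [bQ _ fQ] [bS _ _] c a; split=> [QS|[b Scb Qba] c' atc' c'c]; last first.
  have [b' [atb' b'b Sb'c']] := Scb _ atc' c'c.
  have [a' [ata' a'a Qa'b']] := Qba _ atb' b'b.
  by exists a'; split=> //; exists b'.
pose M := [set b : B' | atom b /\ exists a', [/\ atom a', a' <= a & Q a' b]].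
exists (bigjoin M) => [c' atc' c'c|b atb bM].
  have [a' [ata' a'a [b Qa'b Sbc']]] := QS _ atc' c'c.
  have [b' [atb' b'b Qa'b']] := fQ _ _ ata' Qa'b.
  exists b'; split=> //; last exact: bS Sbc' _.
  by apply: le_bigjoin; split=> //; exists a'.
by have [] : M b by apply: atom_le_bigjoin bM => // x [].
Qed.

Lemma directionally_atomic_le (B : caba) :
  directionally_atomic (fun x y : B => x <= y).
Proof.
split=> [p p' q q' p'p pq qq'|A b Ab|a b ata ab]; last by exists a.
  exact: le_trans p'p (le_trans pq qq').
exact: bigjoin_le.
Qed.

Lemma directionally_atomic_comp (B B' B'' : caba)
    (Q : B -> B' -> Prop) (S : B' -> B'' -> Prop) :
  directionally_atomic Q -> directionally_atomic S ->
  directionally_atomic (rel_comp Q S).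
Proof.
move=> [bQ dQ fQ] [bS dS fS]; split.
- move=> p p' q q' p'p [r Qpr Srq] qq'; exists r; first exact: bQ Qpr _.
  exact: bS Srq qq'.
- move=> A c Ac; exists (bigjoin [set b | S b c]); last exact: dS.
  apply: dQ => a /Ac[b Qab Sbc]; apply: (bQ _ _ _ _ (lexx a) Qab).
  exact: le_bigjoin.
- move=> a c ata [b Qab Sbc]; have [b' [atb' b'b Qab']] := fQ _ _ ata Qab.
  have [c' [atc' c'c Sb'c']] := fS _ _ atb' (bS _ _ _ _ b'b Sbc (lexx c)).
  by exists c'; split=> //; exists b'.
Qed.

Lemma variant_le (B : caba) (x y : B) :
  variant (fun x y : B => x <= y) x y <-> x <= y.
Proof.
split=> [xy|xy a ata ax]; last by exists a; split=> //; exact: le_trans xy.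
apply: le_atoms => a ata ax; have [b [atb bley bla]] := xy a ata ax.
by rewrite -(atom_le_eq atb ata bla).
Qed.

Lemma bisimulatory_le (B : cabao) : bisimulatory (fun x y : B => x <= y).
Proof.
split; (split; first exact: directionally_atomic_le) => x y.
  by rewrite diamP.
by move=> /variant_le xy; apply/variant_le; rewrite diamP.
Qed.

Lemma bisimulatory_comp (B B' B'' : cabao)
    (Q : B -> B' -> Prop) (S : B' -> B'' -> Prop) :
  bisimulatory Q -> bisimulatory S -> bisimulatory (rel_comp Q S).
Proof.
move=> [[dQ sQ] [_ cQ]] [[dS sS] [_ cS]].
split; (split; first exact: directionally_atomic_comp).
  move=> a c [b Qab Sbc]; exists (diam b); last exact: sS.
  by case: dQ => bQ _ _; apply: sQ; exact: bQ Qab (le_box_diam b).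
move=> c a /(variant_comp dQ dS)[b Scb Qba]; apply/(variant_comp dQ dS).
exists (diam b); last exact: cQ.
by apply: cS; exact: variant_bimodule Scb (le_box_diam b).
Qed.

Definition bisimul_id (B : cabao) : bisimul B B := Bisimul (@bisimulatory_le B).

Definition bisimul_comp (B B' B'' : cabao)
    (Q : bisimul B B') (S : bisimul B' B'') : bisimul B B'' :=
  Bisimul (bisimulatory_comp (bisimulP Q) (bisimulP S)).

Lemma bisimul_idl (B B' : cabao) (Q : bisimul B B') :
  bisimul_comp (bisimul_id B) Q = Q.
Proof.
apply: bisimul_eq => x y; split=> [[z /= xz Qzy]|Qxy]; last by exists x => /=.
by have [[[bQ _ _] _] _] := bisimulP Q; exact: bQ xz Qzy (lexx y).
Qed.

Lemma bisimul_idr (B B' : cabao) (Q : bisimul B B') :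
  bisimul_comp Q (bisimul_id B') = Q.
Proof.
apply: bisimul_eq => x y; split=> [[z /= Qxz zy]|Qxy]; last by exists y => /=.
by have [[[bQ _ _] _] _] := bisimulP Q; exact: bQ (lexx x) Qxz zy.
Qed.

Lemma bisimul_assoc (B0 B1 B2 B3 : cabao)
    (Q : bisimul B0 B1) (S : bisimul B1 B2) (T : bisimul B2 B3) :
  bisimul_comp Q (bisimul_comp S T) = bisimul_comp (bisimul_comp Q S) T.
Proof.
apply: bisimul_eq => w z; split.
  by move=> [x Qwx [y Sxy Tyz]]; exists y => //; exists x.
by move=> [y [x Qwx Sxy] Tyz]; exists x => //; exists y.
Qed.

Definition CABAOBisim : category :=
  @Category cabao bisimul bisimul_id bisimul_comp
    bisimul_idl bisimul_idr bisimul_assoc.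

Section PowersetCaba.
Variable X : Type.

Lemma atom_set1 (x : X) : atom [set x].
Proof.
split=> [x0|b /subsetPset bx]; first by have : (set0 : set X) x by rewrite -[set0]x0.
have [->|/set0P[y by_]] := eqVneq b set0; [by left|right].
rewrite eqEsubset; split=> // _ ->.
by rewrite -(bx _ by_).
Qed.

Lemma atom_setE (A : set X) : atom A <-> exists x, A = [set x].
Proof.
split=> [[/eqP/set0P[x Ax] hA]|[x ->]]; last exact: atom_set1.
exists x; case: (hA [set x]) => [|x0|->//]; first by apply/subsetPset => _ ->.
by have : (set0 : set X) x by rewrite -[set0]x0.
Qed.

Lemma powerset_complete (A : set (set X)) :
  supremums A !=set0 /\ infimums A !=set0.
Proof.
split.
  exists (\bigcup_(S in A) S); split=> S AS; apply/subsetPset => x.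
    by move=> Sx; exists S.
  by move=> [T AT Tx]; exact: (subsetPset _ _ (AS T AT)).
exists (\bigcap_(S in A) S); split=> S AS; apply/subsetPset => x.
  by apply.
by move=> Sx T AT; exact: (subsetPset _ _ (AS T AT)).
Qed.

Lemma powerset_atomic (A : set X) :
  A <> \bot -> exists2 a : set X, atom a & a <= A.
Proof.
move=> /eqP/set0P[x Ax]; exists [set x]; first exact: atom_set1.
by apply/subsetPset => _ ->.
Qed.

Definition powerset_caba : caba := Caba powerset_complete powerset_atomic.

Lemma bigmeet_setE (A : set powerset_caba) :
  bigmeet A = \bigcap_(S in A) S :> set X.
Proof.
rewrite eqEsubset; split.
  by move=> x mx S AS; have /subsetPset := bigmeet_le AS; apply.
apply/subsetPset; apply: (@le_bigmeet powerset_caba) => S AS.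
by apply/subsetPset => x; apply.
Qed.

Lemma bigjoin_setE (A : set powerset_caba) :
  bigjoin A = \bigcup_(S in A) S :> set X.
Proof.
rewrite eqEsubset; split; last first.
  by move=> x [S AS Sx]; have /subsetPset := le_bigjoin AS; apply.
apply/subsetPset; apply: (@bigjoin_le powerset_caba) => S AS.
by apply/subsetPset => x Sx; exists S.
Qed.

End PowersetCaba.

Definition frame_box (X : frame) (A : set X) : set X :=
  [set w | forall v, acc w v -> A v].

Definition frame_diam (X : frame) (A : set X) : set X :=
  [set w | exists2 v, A v & acc v w].

Lemma frame_box_meet (X : frame) (A : set (powerset_caba X)) :
  frame_box (bigmeet A) = bigmeet [set (frame_box S : powerset_caba X) | S in A]
    :> set X.
Proof.
rewrite !bigmeet_setE; rewrite eqEsubset; split=> w.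
  by move=> H _ [S AS <-] v wv; exact: H wv S AS.
by move=> H v wv S AS; have := H (frame_box S); apply=> //; exists S.
Qed.

Definition powerset_cabao (X : frame) : cabao :=
  @Cabao (powerset_caba X) (@frame_box X) (@frame_box_meet X).

Lemma powerset_diamE (X : frame) (A : powerset_cabao X) :
  diam A = frame_diam A :> set X.
Proof.
apply: (@le_anti _ (set X)); rewrite (diamP (B := powerset_cabao X)).
apply/andP; split; apply/subsetPset.
  by move=> v Av w vw; exists v.
by move=> w [v Av]; have /subsetPset := @le_box_diam (powerset_cabao X) A; apply.
Qed.

Section LowTheory.

Lemma Low_directionally_atomic (X Y : Type) (Q : X -> Y -> Prop) :
  @directionally_atomic (powerset_caba X) (powerset_caba Y) (Low Q).
Proof.
split.
- move=> p p' q q' /subsetPset p'p Qpq /subsetPset qq' s /p'p/Qpq[t qt Qst].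
  by exists t => //; exact: qq'.
- by move=> A T AT s; rewrite bigjoin_setE => -[S /AT AS /AS].
- move=> a b /atom_setE[x ->] /(_ x erefl)[y by_ Qxy].
  exists [set y]; split; first exact: atom_set1.
    by apply/subsetPset => _ ->.
  by move=> _ ->; exists y.
Qed.

Lemma variant_Low (X Y : Type) (Q : X -> Y -> Prop) (S : set Y) (T : set X) :
  @variant (powerset_caba X) (powerset_caba Y) (Low Q) S T <->
  Low (converse Q) S T.
Proof.
split=> [H s Ss|H a' /atom_setE[s ->] /subsetPset/(_ s erefl)/H[t Tt Qts]].
  have sS : ([set s] : set Y) <= S by apply/subsetPset => _ ->.
  have [_ [/atom_setE[t ->] /subsetPset tT]] := H _ (atom_set1 s) sS.
  by move=> /(_ t erefl)[_ -> Qts]; exists t => //; exact: tT.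
exists [set t]; split; first exact: atom_set1.
  by apply/subsetPset => _ ->.
by move=> _ ->; exists s.
Qed.


Lemma simulation_Low (X Y : frame) (Q : X -> Y -> Prop) (S : set X) (T : set Y) :
  simulation Q -> Low Q S (frame_box T) -> Low Q (frame_diam S) T.
Proof.
move=> sQ QST w [v Sv vw]; have [y Ty Qvy] := QST v Sv.
by have [y' yy' Qwy'] := sQ _ _ _ Qvy vw; exists y' => //; exact: Ty.
Qed.

Lemma Low_bisimulatory (X Y : frame) (Q : X -> Y -> Prop) : bisimulation Q ->
  @bisimulatory (powerset_cabao X) (powerset_cabao Y) (Low Q).
Proof.
move=> [sQ cQ]; split; (split; first exact: Low_directionally_atomic) => S T.
  by rewrite powerset_diamE; exact: simulation_Low.
rewrite powerset_diamE => /variant_Low ST; apply/variant_Low.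
exact: simulation_Low.
Qed.

Lemma bisimulation_converse (X Y : frame) (Q : X -> Y -> Prop) :
  bisimulation Q -> bisimulation (converse Q).
Proof. by move=> []. Qed.

End LowTheory.

Definition Low_fmap (X Y : frame) (Q : bisim X Y) :
  bisimul (powerset_cabao Y) (powerset_cabao X) :=
  @Bisimul (powerset_cabao Y) (powerset_cabao X) (Low (converse Q))
    (Low_bisimulatory (bisimulation_converse (bisimP Q))).

Lemma Low_fmap_id (X : frame) :
  Low_fmap (bisim_id X) = bisimul_id (powerset_cabao X).
Proof.
apply: bisimul_eq => S T; split=> [ST|/subsetPset ST s Ss].
  by apply/subsetPset => s /ST[t Tt /= <-].
by exists s => //; exact: ST.
Qed.

Lemma Low_fmap_comp (X Y Z : frame) (Q : bisim X Y) (S : bisim Y Z) :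
  Low_fmap (bisim_comp Q S) = bisimul_comp (Low_fmap S) (Low_fmap Q).
Proof.
apply: bisimul_eq => A C; split=> [AC|[B AB BC] z /AB[y By Syz]]; last first.
  by have [x Cx Qxy] := BC y By; exists x => //; exists y.
exists [set y | exists2 x, C x & Q x y] => [z /AC[x Cx [y Qxy Syz]]|y [x]].
  by exists y => //; exists x.
by exists x.
Qed.

Definition Low_functor : functor (op_category FrmBisim) CABAOBisim :=
  @Functor (op_category FrmBisim) CABAOBisim powerset_cabao
    (fun X Y (Q : bisim Y X) => Low_fmap Q)
    Low_fmap_id (fun X Y Z Q S => Low_fmap_comp S Q).

(* Main.v *)
From mathcomp Require Import all_boot all_order.
From mathcomp Require Import boolp classical_sets.
Require Import Defs.

(** [Low_functor] is fully faithful and essentially surjective. A bisimulatory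
relation between powersets is determined by its restriction to singletons, and
that restriction is a bisimulation because [S <= box (diam S)] turns the
(co)simulatory condition into a condition on [diam] of singletons. A CABAO [B]
is isomorphic to the powerset of the frame of its atoms, in which [a] sees the
atoms below [diam a]; the comparison works because [diam], as a left adjoint,
is determined by its values on atoms. *)

Set Implicit Arguments.
Unset Strict Implicit.
Unset Printing Implicit Defensive.

Import Order.Theory.

Local Open Scope classical_set_scope.
Local Open Scope order_scope.

(** * Equivalences from full, faithful, essentially surjective functors *)

Section FullyFaithfulEssentiallySurjective.
Variables (C D : category) (F : functor C D).
Hypothesis F_faithful : forall x y (f g : hom x y),
  fmap F f = fmap F g -> f = g.
Hypothesis F_full : forall x y (g : hom (F x) (F y)), exists f, fmap F f = g.
Hypothesis F_eso : forall d : D, exists c (e : hom (F c) d), is_iso e.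

Let preob (d : D) : C := sval (cid (F_eso d)).

Let counit (d : D) : hom (F (preob d)) d := sval (cid (svalP (cid (F_eso d)))).

Let counit_iso d : is_iso (counit d).
Proof. exact: svalP (cid (svalP (cid (F_eso d)))). Qed.

Let counitV (d : D) : hom d (F (preob d)) := sval (cid (counit_iso d)).

Let counitK d : comp (counit d) (counitV d) = idm _.
Proof. by have [] := svalP (cid (counit_iso d)). Qed.

Let counitVK d : comp (counitV d) (counit d) = idm _.
Proof. by have [] := svalP (cid (counit_iso d)). Qed.

Let lift x y (g : hom (F x) (F y)) : hom x y := sval (cid (F_full g)).

Let liftK x y (g : hom (F x) (F y)) : fmap F (lift g) = g.
Proof. exact: svalP (cid (F_full g)). Qed.

(** Conjugation by the chosen isomorphisms, pulled back along [F]; since [F] is faithful,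
    functoriality can be checked after applying [F]. *)
Let premap d d' (g : hom d d') : hom (preob d) (preob d') :=
  lift (comp (comp (counit d) g) (counitV d')).

Let premap_id d : premap (idm d) = idm (preob d).
Proof. by apply: F_faithful; rewrite liftK fmap_id comp_idr counitK. Qed.

Let premap_comp d d' d'' (g : hom d d') (h : hom d' d'') :
  premap (comp g h) = comp (premap g) (premap h).
Proof.
apply: F_faithful; rewrite fmap_comp !liftK -!comp_assoc; congr comp.
by congr comp; rewrite !comp_assoc counitVK comp_idl.
Qed.

Lemma fully_faithful_eso_equivalence : is_equivalence F.
Proof.
exists (@Functor D C preob premap premap_id premap_comp); split.
  exists (fun x => lift (counit (F x))); split=> [x y f|x].
    apply: F_faithful; rewrite !fmap_comp /= !liftK.
    by rewrite -!comp_assoc counitVK comp_idr.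
  exists (lift (counitV (F x))).
  split; apply: F_faithful; rewrite fmap_comp !liftK fmap_id;
    [exact: counitK|exact: counitVK].
exists counit; split=> [d d' g|d]; last exact: counit_iso.
by rewrite /= liftK -!comp_assoc counitVK comp_idr.
Qed.

End FullyFaithfulEssentiallySurjective.

(** * Relations between powersets and their restriction to singletons *)

Section PowersetBisimul.
Variables X Y : frame.

(** Forwards, [S] is the join of its singletons, so left-disjunctivity applies. Backwards,
    atomic-foundedness at [[set s]] yields a singleton inside [T]. *)
Lemma directionally_atomic_set1 (Q : set X -> set Y -> Prop) :
  @directionally_atomic (powerset_caba X) (powerset_caba Y) Q ->
  forall S T, Low (fun x y => Q [set x] [set y]) S T <-> Q S T.
Proof.
move=> [bQ dQ fQ] S T; split=> [ST|QST s Ss].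
  have -> : S = @bigjoin (powerset_caba X) [set [set s] | s in S].
    rewrite bigjoin_setE; apply/seteqP; split=> [s Ss|s [_ [t St <-] ->//]].
    by exists [set s] => //; exists s.
  apply: dQ => _ [s /ST[t Tt Qst] <-]; apply: bQ (lexx _) Qst _.
  by apply/subsetPset => _ ->.
have /(fQ _ _ (atom_set1 s)) : Q [set s] T.
  by apply: bQ (QST) (lexx _); apply/subsetPset => _ ->.
move=> [_ [/atom_setE[t ->] /subsetPset tT Qst]]; exists t => //.
exact: tT.
Qed.

Lemma bisimulatory_set1 (Q : set X -> set Y -> Prop) :
  @bisimulatory (powerset_cabao X) (powerset_cabao Y) Q ->
  bisimulation (fun x y => Q [set x] [set y]).
Proof.
have le_frame_box (Z : frame) (z : Z) :
    [set z] `<=` frame_box (frame_diam [set z]).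
  by move=> _ -> v zv; exists z.
move=> [[dQ sQ] [_ cQ]]; split=> [x y x' Qxy xx'|y x y' Qxy yy'].
  have QE := directionally_atomic_set1 dQ.
  (* The target [[set y]] is enlarged to a box so that [sQ] applies; members of [frame_diam [set y]]
     are the successors of [y]. *)
  have /sQ : Q [set x] (frame_box (frame_diam [set y])).
    apply/QE => _ ->; exists y => //; exact: le_frame_box.
  rewrite powerset_diamE => /QE /(_ x')[]; first by exists x.
  by move=> y' [_ -> yy'] Qxy'; exists y'.
have QE : Low (fun x y => Q [set x] [set y]) = Q.
  by apply/predeq2P => S T; exact: directionally_atomic_set1.
(* Since the variant of [Low] is [Low] of the converse, the cosimulatory condition becomes the
   simulatory one for the converse, and the previous argument repeats. *)
have {}cQ S T : Low (converse (fun x y => Q [set x] [set y])) S (frame_box T) ->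
    Low (converse (fun x y => Q [set x] [set y])) (frame_diam S) T.
  move=> /variant_Low; rewrite QE => /cQ.
  by rewrite powerset_diamE -{1}QE => /variant_Low.
have /cQ/(_ y')[] : Low (converse (fun x y => Q [set x] [set y])) [set y]
    (frame_box (frame_diam [set x])).
- by move=> _ ->; exists x => //; exact: le_frame_box.
- by exists y.
- by move=> x' [_ -> xx'] Qxy'; exists x'.
Qed.

End PowersetBisimul.

(** * Full faithfulness *)

Lemma Low_functor_faithful (X Y : op_category FrmBisim) (Q S : hom X Y) :
  fmap Low_functor Q = fmap Low_functor S -> Q = S.
Proof.
move=> /(congr1 (@bisimul_rel _ _)) /= QS; apply: bisim_eq => y x.
have LowE (T : Y -> X -> Prop) : Low (converse T) [set x] [set y] <-> T y x.
  by split=> [/(_ x erefl)[_ ->]//|Tyx _ ->]; exists y.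
by rewrite -(LowE Q) -(LowE S) QS.
Qed.

Lemma Low_functor_full (X Y : op_category FrmBisim)
    (Q : hom (Low_functor X) (Low_functor Y)) :
  exists S : hom X Y, fmap Low_functor S = Q.
Proof.
have [[dQ _] _] := bisimulP Q.
exists (Bisim (bisimulation_converse (bisimulatory_set1 (bisimulP Q)))).
by apply: bisimul_eq => A B; exact: (directionally_atomic_set1 dQ A B).
Qed.

(** * The frame of atoms and essential surjectivity *)

Section AtomFrame.
Variable B : cabao.

Definition atom_frame : frame :=
  @Frame {a : B | atom a} (fun a a' => sval a' <= diam (sval a)).

Lemma atom_frame_le_eq (a c : atom_frame) : sval a <= sval c -> a = c.
Proof.
case: a c => [a ata] [c atc] /= ac; apply: eq_exist; exact: atom_le_eq ac.
Qed.

(** By adjunction, [diam b] lies below the join of [M] once every atom of [b] lies below the box of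
    that join; an atom below a join of atoms is one of them. *)
Lemma atom_le_diam (a b : B) : atom a -> a <= diam b ->
  exists a', [/\ atom a', a' <= b & a <= diam a'].
Proof.
pose M := [set c : B | atom c /\
  exists a', [/\ atom a', a' <= b & c <= diam a']].
move=> ata abd; suff [] : M a by [].
apply: atom_le_bigjoin => [x []//|//|]; apply: le_trans abd _; rewrite diamP.
apply: le_atoms => a' ata' a'b; rewrite -diamP; apply: le_atoms => c atc ca'.
by apply: le_bigjoin; split=> //; exists a'.
Qed.

(** With [b] identified with its set of atoms, this and [le_atoms_in] are the two inclusions; they
    become mutually inverse morphisms. *)
Definition atoms_le (S : set atom_frame) (b : B) : Prop :=
  forall a, S a -> sval a <= b.

Definition le_atoms_in (b : B) (S : set atom_frame) : Prop :=
  forall a, sval a <= b -> S a.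

Lemma atoms_le_directionally_atomic :
  @directionally_atomic (powerset_cabao atom_frame) B atoms_le.
Proof.
split.
- move=> S S' b b' /subsetPset S'S Sb bb' a /S'S/Sb ab; exact: le_trans bb'.
- by move=> A b Ab a; rewrite bigjoin_setE => -[S /Ab Sb /Sb].
- move=> _ b /atom_setE[a ->] /(_ a erefl) ab; exists (sval a).
  by split=> //; [exact: svalP a|move=> _ ->].
Qed.

Lemma le_atoms_in_directionally_atomic :
  @directionally_atomic B (powerset_cabao atom_frame) le_atoms_in.
Proof.
split.
- move=> b b' S S' b'b bS /subsetPset SS' a ab'; apply/SS'/bS.
  exact: le_trans b'b.
- move=> A S AS a aA.
  (* Members of [A] need not be atoms, so [A] is replaced by the atoms below them, whose join is at
     least as large. *)
  pose M := [set c : B | atom c /\ exists2 x, A x & c <= x].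
  suff [_ [x Ax ax]] : M (sval a) by exact: AS Ax a ax.
  apply: atom_le_bigjoin; [by move=> ? []|exact: svalP a|].
  apply: le_trans aA _; apply: bigjoin_le => x Ax; apply: le_atoms => c atc cx.
  by apply: le_bigjoin; split=> //; exists x.
- move=> a S ata aS; exists [set (exist _ a ata : atom_frame)]; split.
  + exact: atom_set1.
  + by apply/subsetPset => _ ->; exact: aS.
  + by move=> c ca; exact: atom_frame_le_eq.
Qed.

(** Comparable atoms are equal, so passing to variants exchanges the two relations, and each
    cosimulatory condition becomes the simulatory one of the other. *)
Lemma variant_atoms_le b S :
  @variant (powerset_cabao atom_frame) B atoms_le b S <-> le_atoms_in b S.
Proof.
split=> [bS a ab|bS a ata ab].
  have [_ [/atom_setE[c ->] /subsetPset cS]] := bS _ (svalP a) ab.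
  move=> /(_ c erefl) ca; rewrite -(atom_frame_le_eq ca); exact: cS.
exists [set (exist _ a ata : atom_frame)]; split; first exact: atom_set1.
  by apply/subsetPset => _ ->; exact: bS.
by move=> _ ->.
Qed.

Lemma variant_le_atoms_in S b :
  @variant B (powerset_cabao atom_frame) le_atoms_in S b <-> atoms_le S b.
Proof.
split=> [Sb a Sa|Sb _ /atom_setE[a ->] /subsetPset aS].
  have aS : ([set a] : powerset_cabao atom_frame) <= S.
    by apply/subsetPset => _ ->.
  have [c [atc cb ca]] := Sb _ (atom_set1 a) aS.
  by rewrite -(ca (exist _ c atc) (lexx c)).
exists (sval a); split; [exact: svalP a|exact/Sb/aS|move=> c ca].
exact: atom_frame_le_eq.
Qed.

Lemma atoms_le_diam (S : set atom_frame) b :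
  atoms_le S (box b) -> atoms_le (frame_diam S) b.
Proof.
move=> Sb a [c Sc ac]; apply: le_trans ac _; rewrite diamP; exact: Sb.
Qed.

Lemma le_atoms_in_diam b (S : set atom_frame) :
  le_atoms_in b (frame_box S) -> le_atoms_in (diam b) S.
Proof.
move=> bS a /(atom_le_diam (svalP a))[c [atc cb ac]].
exact: bS (exist _ c atc) cb a ac.
Qed.

Lemma atoms_le_bisimulatory :
  @bisimulatory (powerset_cabao atom_frame) B atoms_le.
Proof.
split; (split; first exact: atoms_le_directionally_atomic).
  by move=> S b; rewrite powerset_diamE; exact: atoms_le_diam.
by move=> b S /variant_atoms_le/le_atoms_in_diam bS; apply/variant_atoms_le.
Qed.

Lemma le_atoms_in_bisimulatory :
  @bisimulatory B (powerset_cabao atom_frame) le_atoms_in.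
Proof.
split; (split; first exact: le_atoms_in_directionally_atomic).
  exact: le_atoms_in_diam.
move=> S b /variant_le_atoms_in/atoms_le_diam; rewrite -powerset_diamE => Sb.
exact/variant_le_atoms_in.
Qed.

Lemma Low_functor_eso :
  exists (X : op_category FrmBisim) (e : hom (Low_functor X) (B : CABAOBisim)),
    is_iso e.
Proof.
exists atom_frame, (Bisimul atoms_le_bisimulatory).
exists (Bisimul le_atoms_in_bisimulatory).
split; apply: bisimul_eq.
  move=> S T; split=> [[b Sb bT]|/subsetPset ST].
    by apply/subsetPset => a /Sb/bT.
  pose M : set B := [set sval a | a in S].
  (* The join of [S] interpolates between [S] and [T]: the atoms below it are exactly those in
     [S]. *)
  exists (bigjoin M) => [a Sa|a aM]; first by apply: le_bigjoin; exists a.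
  suff [c Sc ca] : M (sval a).
    by apply: ST; rewrite -(@atom_frame_le_eq c a) ?ca.
  apply: atom_le_bigjoin (svalP a) aM => _ [c _ <-]; exact: svalP c.
move=> b c; split=> [[S bS Sc]|bc].
  apply: le_atoms => a ata ab; pose a' : atom_frame := exist _ a ata.
  exact: (Sc a' (bS a' ab)).
by exists [set a : atom_frame | sval a <= b] => // a ab; exact: le_trans bc.
Qed.

End AtomFrame.

Theorem mainTheorem5 : is_equivalence Low_functor.
Proof.
apply: fully_faithful_eso_equivalence.
- exact: Low_functor_faithful.
- exact: Low_functor_full.
- exact: Low_functor_eso.
Qed.
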